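(* Let $p$ be an odd prime and $n$ odd. For each $0\le k\le p-1$ let $c_k\in\mathbb{F}_p^*$ and let $g_k(x)=c_k\mathrm{Tr}_n(x^{p^{r_k}+1}-x^{p^{t_k}+1})$ with integers $r_k>t_k\ge0$ satisfying $\gcd(n,r_k+t_k)=\gcd(n,r_k-t_k)=\gcd(n,p)=1$ (so each $g_k$ is near-bent and its linearized polynomial has kernel $\mathbb{F}_p$). Let $b_0,\ldots,b_{p-1}\in\mathbb{F}_{p^n}$ satisfy $g_k(1)+\mathrm{Tr}_n(b_k)=g_0(1)+k$, put $f_k(x)=g_k(x)+\mathrm{Tr}_n(b_kx)$, and \[F(x,y)=(p-1)\sum_{k=0}^{p-1}\Big(\prod_{j\in\mathbb{F}_p,j\ne k}(y-j)\Big)f_k(x).\] Then $F:\mathbb{F}_{p^n}\times\mathbb{F}_p\to\mathbb{F}_p$ is a weakly regular bent function.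
   Context: $\epsilon_p=e^{2\pi i/p}$, $\mathrm{Tr}_n$ the absolute trace $\mathbb{F}_{p^n}\to\mathbb{F}_p$; for $F$ on $\mathbb{F}_{p^n}\times\mathbb{F}_p$, $\widehat F(a,b)=\sum_{x,y}\epsilon_p^{F(x,y)-\mathrm{Tr}_n(ax)-by}$. A bent function $F$ on an $m$-dimensional space ($|\widehat F(w)|^2=p^m$ for all $w$) is weakly regular if there is a complex $\zeta$ with $|\zeta|=1$ and a function $F^*$ into $\mathbb{F}_p$ with $p^{-m/2}\widehat F(w)=\zeta\,\epsilon_p^{F^*(w)}$ for all $w$. *)

(* Defs.v *)
From HB Require Import structures.
From mathcomp Require Import all_boot all_order all_algebra all_field.
Set Implicit Arguments. Unset Strict Implicit. Unset Printing Implicit Defensive.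
Import Order.TTheory GRing.Theory Num.Theory.
Local Open Scope ring_scope.

(* epsilon_p = e^{2 pi i / p} in algC: p.-root (-1) = e^{i pi / p}
   (root with minimal nonnegative argument), squared. *)
Definition eps (p : nat) : algC := (p.-root (-1)) ^+ 2.

Definition trK (K : finFieldType) (p n : nat) (x : K) : K :=
  \sum_(i < n) x ^+ (p ^ i).

Definition Tr (K : finFieldType) (p n : nat) (x : K) : 'F_p :=
  odflt 0 [pick k : 'F_p | (nat_of_ord k)%:R == trK p n x].

Arguments Tr {K} p n x.
Arguments trK {K} p n x.

Definition epow (p : nat) (a : 'F_p) : algC := eps p ^+ (nat_of_ord a).
Arguments epow p a : clear implicits.

Arguments eps p : clear implicits.
Definition walsh (K : finFieldType) (p n : nat) (F : K -> 'F_p -> 'F_p)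
  (a : K) (b : 'F_p) : algC :=
  \sum_(x : K) \sum_(y : 'F_p) epow p (F x y - Tr p n (a * x) - b * y).

Arguments walsh {K} p n F a b.

(* bent on the (n+1)-dimensional F_p-space F_{p^n} x F_p *)
Definition bent (K : finFieldType) (p n : nat) (F : K -> 'F_p -> 'F_p) : Prop :=
  forall a b, `|walsh p n F a b| ^+ 2 = (p ^ n.+1)%:R.

Arguments bent {K} p n F.

Definition weakly_regular_bent (K : finFieldType) (p n : nat)
  (F : K -> 'F_p -> 'F_p) : Prop :=
  bent p n F /\
  exists (zeta : algC) (Fs : K -> 'F_p -> 'F_p),
    `|zeta| = 1 /\
    forall a b, (sqrtC (p ^ n.+1)%:R)^-1 * walsh p n F a b = zeta * epow p (Fs a b).
Arguments weakly_regular_bent {K} p n F.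

(* Main.v *)
(* Write [Q_k] for the quadratic form [g_k].  Interpolation gives
   [F(x, k) = f_k(x)], and the kernel condition makes the prime field the radical
   of [Q_k], on which [Q_k] vanishes, so that [Tr(b_k) = k].  Translating by [1]
   shows that the Walsh sum of [f_k] at [a] vanishes unless [k = Tr a]; for
   [k = Tr a], completing the square turns it into a root of unity times the
   Gauss sum [S_k] of [Q_k].  Hence everything reduces to showing that [S_k] does
   not depend on [k].

   To see this without computing discriminants, consider for [d | n] the sum
   [S_k(d)] of [eps ^ Q_k] over the subfield of order [p ^ d].  One has
   [|S_k(d)|^2 = p * p^d], and [S_k(d)^2] is real because [-1] is a sum of two
   squares in [F_p], so [S_k(d)^4] does not depend on [k].  If [d = l * m] with
   [l] prime, the [m]-th iterate of Frobenius acts on the subfield with orbits of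
   size [1] or [l] and preserves [Q_k], so [S_k(d)] is congruent to [S_k(m)]
   modulo [l].  As [l] is odd and different from [p], the fourth power and the
   residue modulo [l] determine [S_k(d)], by induction on [d]. *)
Require Import Defs.
From HB Require Import structures.
From mathcomp Require Import all_boot all_order all_algebra all_fingroup all_solvable all_field.
From mathcomp Require Import ring.
Import Order.TTheory GRing.Theory Num.Theory.
Local Open Scope ring_scope.

Set Implicit Arguments.
Unset Strict Implicit.
Unset Printing Implicit Defensive.

(** * Roots of unity and the additive character of the prime field *)

Lemma norm_unity_root (m : nat) (x : algC) : (0 < m)%N -> x ^+ m = 1 -> `|x| = 1.
Proof.
by move=> m_gt0 xm; apply/eqP; rewrite -(@pexpr_eq1 _ _ m) // -normrX xm normr1.
Qed.

Section AdditiveCharacter.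

Variable p : nat.
Hypotheses (p_prime : prime p) (p_odd : odd p).

(** Among the roots in the closed upper half plane, [p.-root] has the largest real part. On the unit
    circle [-1] has the smallest, so it loses to [- w] or its conjugate, where [w] is a primitive
    [p]-th root of unity. *)
Lemma rootCN1_neqN1 : p.-root (-1 : algC) != -1.
Proof.
have p_gt0 := prime_gt0 p_prime.
apply/eqP => root_eq.
have [w w_prim] := C_prim_root_exists p_gt0.
have w_neq1 : w != 1.
  by rewrite -[w]expr1 -(prim_order_dvd w_prim) dvdn1 neq_ltn prime_gt1 ?orbT.
have opp_w_root : (- w) ^+ p = -1.
  by rewrite exprNn (prim_expr_order w_prim) mulr1 -signr_odd p_odd.
have norm_w : `|w| = 1.
  by apply: (norm_unity_root p_gt0); rewrite prim_expr_order.
suff [y [y_root im_y norm_y y_neq]] :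
    exists y : algC, [/\ y ^+ p = -1, 0 <= 'Im y, `|y| = 1 & y != -1].
  have := rootC_Re_max p_gt0 y_root im_y; rewrite root_eq.
  rewrite raddfN /= (Creal_ReP 1 _) ?rpred1 // => re_y.
  have := normC2_Re_Im y; rewrite norm_y expr1n => sq1.
  have re_sq : 1 <= ('Re y) ^+ 2.
    by rewrite -sqrrN exprn_ege1 // lerNr.
  have im0 : 'Im y = 0.
    apply/eqP; rewrite -sqrf_eq0 eq_le -(lerD2l (('Re y) ^+ 2)) -sq1 addr0.
    by rewrite re_sq real_exprn_even_ge0 ?Creal_Im.
  have re_eq : 'Re y = -1.
    move: sq1; rewrite im0 expr0n addr0 => /esym /eqP; rewrite sqrf_eq1.
    case/orP=> /eqP // re1; move: re_y; rewrite re1.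
    by rewrite lerNr => /(le_trans ler01); rewrite oppr_ge0 ler10.
  by case/eqP: y_neq; rewrite [y]Crect im0 mulr0 addr0.
have opp_w_neq : - w != -1 by rewrite eqr_opp.
have [im_ge0 | im_lt0] := real_leP (real0 _) (Creal_Im (- w)).
  by exists (- w); rewrite normrN.
exists (- w)^*; split.
- by rewrite -rmorphXn opp_w_root rmorphN1.
- by rewrite Im_conj oppr_ge0 ltW.
- by rewrite norm_conjC normrN.
- by rewrite -(rmorphN1 (@Num.conj algC)) (inj_eq (inv_inj (@conjCK _))).
Qed.

Lemma eps_prim_root : p.-primitive_root (eps p).
Proof.
have p_gt0 := prime_gt0 p_prime.
have eps_p : eps p ^+ p = 1 by rewrite /eps -exprM mulnC exprM rootCK // sqrrN expr1n.
have [m m_prim /(primeP p_prime).2] := prim_order_exists p_gt0 eps_p.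
case/pred2P=> m_eq; last by rewrite -m_eq in m_prim *.
have := prim_expr_order m_prim; rewrite m_eq expr1 /eps => /eqP.
rewrite sqrf_eq1 (negPf rootCN1_neqN1) orbF => /eqP r1.
have := rootCK p_gt0 (-1 : algC); rewrite r1 expr1n => /eqP.
by rewrite eq_sym eqNr oner_eq0.
Qed.

Lemma natr_ord_Fp (k : 'F_p) : (nat_of_ord k)%:R = k.
Proof. exact: natr_Zp. Qed.

Lemma epow_natr (m : nat) : epow p m%:R = eps p ^+ m.
Proof.
by rewrite /epow val_Fp_nat // (prim_expr_mod eps_prim_root).
Qed.

Lemma epowD (a b : 'F_p) : epow p (a + b) = epow p a * epow p b.
Proof.
by rewrite -[a]natr_ord_Fp -[b]natr_ord_Fp -natrD !epow_natr exprD.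
Qed.

Lemma epow0 : epow p 0 = 1. Proof. by rewrite (epow_natr 0). Qed.

Lemma epow_unity (a : 'F_p) : epow p a ^+ p = 1.
Proof. by rewrite /epow exprAC (prim_expr_order eps_prim_root) expr1n. Qed.

Lemma norm_epow (a : 'F_p) : `|epow p a| = 1.
Proof. 
by apply: (norm_unity_root (prime_gt0 p_prime)); rewrite epow_unity.
Qed.

Lemma epow_neq0 (a : 'F_p) : epow p a != 0.
Proof. by rewrite -normr_eq0 norm_epow oner_eq0. Qed.

Lemma conj_epow (a : 'F_p) : (epow p a)^* = epow p (- a).
Proof.
apply: (mulfI (epow_neq0 a)).
by rewrite -epowD subrr epow0 -normCK norm_epow expr1n.
Qed.

Lemma epow_eq1 (a : 'F_p) : (epow p a == 1) = (a == 0).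
Proof.
rewrite /epow -(prim_order_dvd eps_prim_root).
rewrite -(inj_eq val_inj) /= /dvdn modn_small //.
by rewrite -[X in (_ < X)%N]Fp_cast.
Qed.

Lemma Aint_epow (a : 'F_p) : epow p a \in Aint.
Proof.
apply: (@Aint_unity_root p); first exact: prime_gt0.
by rewrite unity_rootE epow_unity.
Qed.

(** Translating by [w] multiplies the sum by [epow p v], which differs from 1. *)
Lemma epow_sum_shift (V : finZmodType) (A : pred V) (h : V -> 'F_p) (w : V)
    (v : 'F_p) :
  (forall x, A (x + w) = A x) -> (forall x, A x -> h (x + w) = h x + v) ->
  v != 0 -> \sum_(x | A x) epow p (h x) = 0.
Proof.
move=> Aw hw v_neq0; set S := \sum_(x | _) _.
have : epow p v * S = S.
  rewrite {2}/S (reindex_inj (addIr w)) /= (eq_bigl A) // mulr_sumr.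
  by apply: eq_bigr => x Ax; rewrite hw // epowD mulrC.
move/eqP; rewrite -subr_eq0 -{2}[S]mul1r -mulrBl mulf_eq0 subr_eq0 epow_eq1.
by rewrite (negPf v_neq0) => /eqP.
Qed.

End AdditiveCharacter.

(** * [-1] as a sum of two squares in the prime field *)

Section SumOfTwoSquares.

Variable p : nat.
Hypotheses (p_prime : prime p) (p_odd : odd p).

Lemma card_squares_Fp : (p <= 2 * #|[set x ^+ 2 | x : 'F_p]|)%N.
Proof.
set A := imset _ _.
(* The Boolean tells the two square roots [x] and [- x] apart. *)
pose h (x : 'F_p) := (x ^+ 2, (nat_of_ord x < nat_of_ord (- x)%R)%N).
have h_inj : injective h.
  move=> x y /eqP; rewrite xpair_eqE eqf_sqr => /andP[/orP[/eqP // | /eqP ->] /eqP].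
  rewrite opprK => lt_eq; apply: val_inj => /=.
  by case: ltngtP lt_eq => //= ->.
rewrite -{1}(card_Fp p_prime) -(card_imset predT h_inj).
rewrite mulnC -card_bool -cardsT -cardsX subset_leq_card //.
by apply/subsetP => _ /imsetP[x _ ->]; rewrite in_setX inE andbT; apply: imset_f.
Qed.

(** Pigeonhole: the squares and their reflections [- 1 - x] each fill at least half of the field;
    were they disjoint, [p] would be even. *)
Lemma oppr1_sum_two_squares : exists a b : 'F_p, a ^+ 2 + b ^+ 2 = -1.
Proof.
pose A := [set x ^+ 2 | x : 'F_p].
pose B := [set - 1 - x | x in A].
have cardB : #|B| = #|A| by apply: card_imset => x y /addrI /oppr_inj.
have [dAB | ] := boolP [disjoint A & B].
  have := card_squares_Fp; rewrite -/A => le_p.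
  have : (#|A :|: B| <= p)%N by rewrite (leq_trans (max_card _)) ?card_Fp.
  move: dAB; rewrite -(leq_card_setU A B).2 => /eqP ->.
  rewrite cardB addnn -mul2n => ge_p.
  by move: p_odd; rewrite (@anti_leq p (2 * #|A|)%N) ?le_p // oddM.
case/pred0Pn=> _ /= /andP[/imsetP[a _ ->] /imsetP[_ /imsetP[b _ ->] ab]].
by exists a, b; rewrite ab subrK.
Qed.

End SumOfTwoSquares.

(** * Frobenius iterates, the embedded prime field and the trace *)

Section FrobeniusTrace.

Variables (p n : nat) (K : finFieldType).
Hypotheses (p_prime : prime p) (p_odd : odd p) (charK : p \in [pchar K]).
Hypotheses (cardK : #|K| = (p ^ n)%N) (copnp : coprime n p).

Definition frob (i : nat) (x : K) : K := x ^+ (p ^ i).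

Lemma frobD i x y : frob i (x + y) = frob i x + frob i y.
Proof.
by apply: exprDn_pchar; rewrite pnatX pnatE // charK.
Qed.

Lemma frob0 i : frob i 0 = 0.
Proof. by rewrite /frob expr0n expn_eq0 eqn0Ngt prime_gt0. Qed.

Lemma frobN i x : frob i (- x) = - frob i x.
Proof. by apply/eqP; rewrite -addr_eq0 -frobD addNr frob0. Qed.

Lemma frobB i x y : frob i (x - y) = frob i x - frob i y.
Proof. by rewrite frobD frobN. Qed.

Lemma frobM i x y : frob i (x * y) = frob i x * frob i y.
Proof. exact: exprMn. Qed.

Lemma frob_id x : frob 0 x = x.
Proof. exact: expr1. Qed.

Lemma frob_comp i j x : frob i (frob j x) = frob (i + j) x.
Proof. by rewrite /frob -exprM -expnD addnC. Qed.

Lemma frobC i j x : frob i (frob j x) = frob j (frob i x).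
Proof. by rewrite !frob_comp addnC. Qed.

Lemma frob_period i m x : frob i x = x -> frob (m * i) x = x.
Proof.
by move=> fix_x; elim: m => [|m IHm]; rewrite ?frob_id // mulSn -frob_comp IHm.
Qed.

Lemma frob_n m x : frob (m * n) x = x.
Proof. by apply: frob_period; rewrite /frob -cardK expf_card. Qed.

Lemma frob_inj i : injective (frob i).
Proof.
move=> x y /eqP; rewrite -subr_eq0 -frobB expf_eq0 => /andP[_].
by rewrite subr_eq0 => /eqP.
Qed.

Lemma frob_gcd i j x : (0 < i)%N ->
  frob i x = x -> frob j x = x -> frob (gcdn i j) x = x.
Proof.
move=> i_gt0 fix_i fix_j; case: (egcdnP j i_gt0) => u v Euv _.
have := frob_period u fix_i; rewrite Euv addnC -frob_comp.
by rewrite (frob_period v fix_j).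
Qed.

Definition Fp_inj (k : 'F_p) : K := (nat_of_ord k)%:R.

Lemma Fp_inj_natr m : Fp_inj m%:R = m%:R.
Proof. by rewrite /Fp_inj val_Fp_nat // GRing.natr_mod_pchar. Qed.

Lemma Fp_injD : {morph Fp_inj : a b / a + b}.
Proof.
move=> a b; rewrite -[in LHS](natr_ord_Fp a) -[in LHS](natr_ord_Fp b).
by rewrite -natrD Fp_inj_natr natrD.
Qed.

Lemma Fp_injM : {morph Fp_inj : a b / a * b}.
Proof.
move=> a b; rewrite -[in LHS](natr_ord_Fp a) -[in LHS](natr_ord_Fp b).
by rewrite -natrM Fp_inj_natr natrM.
Qed.

Lemma Fp_inj0 : Fp_inj 0 = 0. Proof. by []. Qed.

Lemma Fp_inj1 : Fp_inj 1 = 1. Proof. exact: (Fp_inj_natr 1). Qed.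

Lemma Fp_injN a : Fp_inj (- a) = - Fp_inj a.
Proof. by apply/eqP; rewrite -addr_eq0 -Fp_injD addNr. Qed.

Lemma Fp_inj_inj : injective Fp_inj.
Proof.
move=> a b /eqP; rewrite -subr_eq0 -Fp_injN -Fp_injD => /eqP eq0.
apply/eqP; rewrite -subr_eq0; move: (a - b) eq0 => d /eqP.
rewrite /Fp_inj -(dvdn_pcharf charK) (dvdn_pcharf (pchar_Fp p_prime)).
by rewrite natr_ord_Fp.
Qed.

Lemma frob_Fp_inj i a : frob i (Fp_inj a) = Fp_inj a.
Proof.
have fix1 : frob 1 (Fp_inj a) = Fp_inj a.
  have injX m : Fp_inj (a ^+ m) = Fp_inj a ^+ m.
    by elim: m => [|m IHm]; rewrite ?Fp_inj1 // !exprS Fp_injM IHm.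
  by rewrite /frob expn1 -injX -[X in a ^+ X](card_Fp p_prime) expf_card.
by rewrite -[i]muln1 frob_period.
Qed.

(** The embedded prime field already supplies [p] roots of ['X^p - 'X]; another fixed point would be
    one root too many. *)
Lemma frob_fixedP x : frob 1 x = x -> exists a, x = Fp_inj a.
Proof.
move=> fix_x; pose rs := codom Fp_inj.
have [/codomP[a ->] | xNrs] := boolP (x \in rs); first by exists a.
have P_neq0 : 'X^p - 'X != 0 :> {poly K}.
  by rewrite -size_poly_eq0 size_polyDl ?size_polyXn // size_polyN size_polyX ltnS prime_gt1.
have rootP y : frob 1 y = y -> root ('X^p - 'X) y.
  by rewrite /root !hornerE subr_eq0 /frob expn1 => ->.
have rs_roots : all (root ('X^p - 'X)) (x :: rs).
  apply/allP=> y; rewrite inE => /orP[/eqP -> | /codomP[a ->]]; apply: rootP => //.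
  exact: frob_Fp_inj.
have rs_uniq : uniq (x :: rs) by rewrite /= xNrs (map_inj_uniq Fp_inj_inj) enum_uniq.
have := max_poly_roots P_neq0 rs_roots rs_uniq.
rewrite size_polyDl ?size_polyXn ?size_polyN ?size_polyX ?ltnS ?prime_gt1 //=.
by rewrite size_codom card_Fp // ltnn.
Qed.

Notation trace := (@trK K p n).
Notation Tr := (@Tr K p n).

Lemma trKE x : trace x = \sum_(i < n) frob i x. Proof. by []. Qed.

Lemma frob_trK x : frob 1 (trace x) = trace x.
Proof.
rewrite !trKE (big_morph (frob 1) (frobD 1) (frob0 1)).
case: n cardK frob_n => [|m] _ per; first by rewrite !big_ord0.
rewrite big_ord_recr big_ord_recl /= addrC frob_id; congr (_ + _).
  by rewrite frob_comp -[RHS](per 1%N) mul1n.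
by apply: eq_bigr => i _; rewrite frob_comp.
Qed.

(** The trace is fixed by Frobenius, hence lies in the prime field, so the default value in [Tr] is
    never taken. *)
Lemma Fp_inj_Tr x : Fp_inj (Tr x) = trace x.
Proof.
rewrite /Defs.Tr; case: pickP => [k /eqP // | none].
have [a Ea] := frob_fixedP (frob_trK x).
by have := none a; rewrite Ea eqxx.
Qed.

Lemma trKD x y : trace (x + y) = trace x + trace y.
Proof. by rewrite -big_split; apply: eq_bigr => i _; apply: frobD. Qed.

Lemma TrD x y : Tr (x + y) = Tr x + Tr y.
Proof. by apply: Fp_inj_inj; rewrite Fp_injD !Fp_inj_Tr trKD. Qed.

Lemma Tr0 : Tr 0 = 0.
Proof. by apply: (addIr (Tr 0)); rewrite -TrD !add0r. Qed.

Lemma TrN x : Tr (- x) = - Tr x.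
Proof. by apply/eqP; rewrite -addr_eq0 -TrD addNr Tr0. Qed.

Lemma TrB x y : Tr (x - y) = Tr x - Tr y.
Proof. by rewrite TrD TrN. Qed.

Lemma TrZ a x : Tr (Fp_inj a * x) = a * Tr x.
Proof.
apply: Fp_inj_inj; rewrite Fp_injM !Fp_inj_Tr !trKE mulr_sumr.
by apply: eq_bigr => i _; rewrite frobM frob_Fp_inj.
Qed.

Lemma Tr_frob i x : Tr (frob i x) = Tr x.
Proof.
apply: Fp_inj_inj; rewrite !Fp_inj_Tr -[RHS](@frob_period 1 i) ?frob_trK //.
rewrite muln1 !trKE (big_morph (frob i) (frobD i) (frob0 i)).
by apply: eq_bigr => j _; rewrite frobC.
Qed.

Lemma Tr1_neq0 : Tr 1 != 0.
Proof.
have -> : Tr 1 = n%:R.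
  apply: Fp_inj_inj; rewrite Fp_inj_Tr Fp_inj_natr trKE.
  rewrite (eq_bigr (fun=> 1)) => [|i _]; last by rewrite /frob expr1n.
  by rewrite sumr_const card_ord.
rewrite -(dvdn_pcharf (pchar_Fp p_prime)) -prime_coprime // coprime_sym //.
Qed.

(** On the prime field the trace is multiplication by [Tr 1], that is, by [n] modulo [p], which is
    invertible. *)
Lemma Tr_fixed_eq0 y : frob 1 y = y -> Tr y = 0 -> y = 0.
Proof.
case/frob_fixedP=> a ->; rewrite -[Fp_inj a]mulr1 TrZ => /eqP.
by rewrite mulf_eq0 (negPf Tr1_neq0) orbF => /eqP ->; rewrite mul0r.
Qed.

Lemma n_gt0 : (0 < n)%N.
Proof.
by case: n copnp => //; rewrite /coprime gcd0n => /eqP p1; move: p_prime; rewrite p1.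
Qed.

(** * Subfields fixed by Frobenius iterates, and character sums over them *)

Definition fixed_by (d : nat) : pred K := fun x => frob d x == x.

Lemma fixed_byE d x : fixed_by d x = (frob d x == x).
Proof. by []. Qed.

Lemma fixed_byD d x y : fixed_by d x -> fixed_by d y -> fixed_by d (x + y).
Proof. by rewrite !fixed_byE frobD => /eqP -> /eqP ->. Qed.

Lemma fixed_byN d x : fixed_by d x -> fixed_by d (- x).
Proof. by rewrite !fixed_byE frobN => /eqP ->. Qed.

Lemma fixed_byM d x y : fixed_by d x -> fixed_by d y -> fixed_by d (x * y).
Proof. by rewrite !fixed_byE frobM => /eqP -> /eqP ->. Qed.

Lemma fixed_by_addr d x y : fixed_by d y -> fixed_by d (x + y) = fixed_by d x.
Proof.
move=> fy; apply/idP/idP => fx; last exact: fixed_byD.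
by rewrite -[x](addrK y) fixed_byD ?fixed_byN.
Qed.

Lemma fixed_by_frob d i x : fixed_by d x -> fixed_by d (frob i x).
Proof. by rewrite !fixed_byE frobC => /eqP ->. Qed.

Lemma fixed_by_Fp_inj d a : fixed_by d (Fp_inj a).
Proof. by rewrite !fixed_byE frob_Fp_inj. Qed.

Lemma fixed_byV d x : fixed_by d x -> fixed_by d x^-1.
Proof. by rewrite !fixed_byE /frob exprVn => /eqP ->. Qed.

Lemma fixed_by1 x : fixed_by 1 x -> forall i, frob i x = x.
Proof. by move=> /eqP fix_x i; rewrite -[i]muln1 frob_period. Qed.

Lemma card_fixed_by1 : #|fixed_by 1| = p.
Proof.
rewrite -(card_Fp p_prime) -(card_codom Fp_inj_inj).
apply: eq_card => x; rewrite unfold_in /=; apply/eqP/codomP => [/frob_fixedP // | [a ->]].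
exact: frob_Fp_inj.
Qed.

(** Lagrange in the additive group. This suffices to show that no prime other than [p] divides the
    cardinality. *)
Lemma card_fixed_by_dvd d : (#|fixed_by d| %| p ^ n)%N.
Proof.
have grp : group_set [set x : K | fixed_by d x].
  apply/group_setP; split=> [|x y]; rewrite ?inE; first by rewrite fixed_byE (frob0 d).
  by move=> fx fy; apply: fixed_byD.
have := cardSg (subsetT (Group grp)); rewrite cardsT cardK /=.
by rewrite cardsE.
Qed.

(** The iterate [frob (n.-1 * i)] is the inverse of [frob i], and the trace is
    Frobenius-invariant. *)
Lemma Tr_adj i x y : Tr (x * frob i y) = Tr (frob (n.-1 * i) x * y).
Proof.
rewrite -[LHS](Tr_frob (n.-1 * i)) frobM frob_comp -mulSnr (prednK n_gt0).
by rewrite (mulnC n i) frob_n.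
Qed.

(** Orthogonality of characters: for nonzero [y], translation by [y^-1] stays in the subfield and
    adds [Tr 1] to the exponent. *)
Lemma sum_epow_Tr d y : fixed_by d y ->
  \sum_(z | fixed_by d z) epow p (Tr (z * y)) =
  if y == 0 then #|fixed_by d|%:R else 0.
Proof.
move=> fy; case: eqP => [-> | /eqP y_neq0].
  rewrite (eq_bigr (fun=> 1)) ?sumr_const // => z _.
  by rewrite mulr0 Tr0 epow0.
apply: (@epow_sum_shift _ p_prime p_odd _ _ _ y^-1 (Tr 1)) => [z | z _|].
- exact/fixed_by_addr/fixed_byV.
- by rewrite mulrDl mulVf // TrD.
- exact: Tr1_neq0.
Qed.

(** * The quadratic forms and their Gauss sums *)

Definition quad (c : 'F_p) (r t : nat) (x : K) : 'F_p :=
  c * Tr (x ^+ (p ^ r).+1 - x ^+ (p ^ t).+1).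

(** The linearized polynomial of the form: [c * Tr (x * quad_op r t y)] is its polar form. The
    factor [n.-1] stands for [-1], as exponents of Frobenius count modulo [n]. *)
Definition quad_op (r t : nat) (x : K) : K :=
  frob r x + frob (n.-1 * r) x - frob t x - frob (n.-1 * t) x.

Definition quad_sum (c : 'F_p) (r t d : nat) : algC :=
  \sum_(x | fixed_by d x) epow p (quad c r t x).

Section OneForm.

Variables (c : 'F_p) (r t : nat).

Local Notation Q := (quad c r t).
Local Notation L := (quad_op r t).
Local Notation S := (quad_sum c r t).

Lemma quadE x : Q x = c * Tr (x * frob r x - x * frob t x).
Proof. by rewrite /quad !exprS. Qed.

Lemma quadD x y : Q (x + y) = Q x + Q y + c * Tr (x * L y).
Proof.
rewrite !quadE -!mulrDr; congr (c * _); rewrite /quad_op !frobD.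
rewrite !(mulrDl, mulrDr, TrB, TrD, mulrN, TrN).
rewrite (Tr_adj r y x) (Tr_adj t y x) ![_ * x]mulrC; ring.
Qed.

Lemma quad_opD x y : L (x + y) = L x + L y.
Proof. by rewrite /quad_op !frobD; ring. Qed.

Lemma quad_opZ a x : L (Fp_inj a * x) = Fp_inj a * L x.
Proof. by rewrite /quad_op !frobM !frob_Fp_inj; ring. Qed.

Lemma quadZ a x : Q (Fp_inj a * x) = a ^+ 2 * Q x.
Proof.
rewrite !quadE !frobM !frob_Fp_inj !(mulrCA _ (Fp_inj a)) -!mulrA -!mulrBr.
rewrite !(mulrCA _ (Fp_inj a)) !TrZ; ring.
Qed.

Lemma quad_frob i x : Q (frob i x) = Q x.
Proof. by rewrite !quadE !(frobC _ i) -!frobM -frobB Tr_frob. Qed.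

Lemma quad_fixed x : fixed_by 1 x -> Q x = 0.
Proof. by move=> fx; rewrite quadE !fixed_by1 // subrr Tr0 mulr0. Qed.

Lemma quad_op_fixed x : fixed_by 1 x -> L x = 0.
Proof. by move=> fx; rewrite /quad_op !fixed_by1 // addrK subrr. Qed.

Lemma fixed_by_quad_op d x : fixed_by d x -> fixed_by d (L x).
Proof. by move=> fx; rewrite !fixed_byD ?fixed_byN ?fixed_by_frob. Qed.

Lemma Tr_quad_op x : Tr (L x) = 0.
Proof. by rewrite /quad_op !(TrD, TrN) !Tr_frob addrK subrr. Qed.

Hypotheses (c_nz : c != 0) (tr : (t < r)%N).
Hypotheses (cop_add : coprime n (r + t)) (cop_sub : coprime n (r - t)).

Lemma quad_op_eq0 x : (L x == 0) = fixed_by 1 x.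
Proof.
apply/eqP/idP => [Lx0 | /quad_op_fixed //].
have fix1 y i : coprime n i -> frob i y = y -> frob 1 y = y.
  move=> /eqP <- fy; apply: frob_gcd fy; first exact: n_gt0.
  by rewrite -[n]mul1n frob_n.
(* Once fixed by [frob (r + t)], [y] lies in the prime field; being a difference of conjugates it
   has trace 0, so it vanishes, and [x] is fixed by [frob (r - t)]. *)
pose y := frob (r - t) x - x.
suff fy : frob (r + t) y = y.
  have y0 : y = 0.
    apply: Tr_fixed_eq0; first exact: fix1 fy.
    by rewrite TrB Tr_frob subrr.
  by apply/eqP/(fix1 _ _ cop_sub)/eqP; rewrite -subr_eq0 -/y y0.
(* [frob r] applied to [L x = 0] is [(frob (r + t) - 1) (frob (r - t) - 1) x = 0] *)
have := congr1 (frob r) Lx0; rewrite frob0 /quad_op !frobB frobD !frob_comp.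
have -> : (r + n.-1 * r = r * n)%N by rewrite -mulSn prednK ?n_gt0 // mulnC.
have -> : (r + n.-1 * t = (r - t) + t * n)%N.
  by rewrite -[in LHS](subnK (ltnW tr)) -addnA -mulSn prednK ?n_gt0 // mulnC.
rewrite -(frob_comp (r - t)) !frob_n => eq0.
apply/eqP; rewrite -subr_eq0; apply/eqP; rewrite -eq0.
have -> : (r + t + (r - t) = r + r)%N by rewrite -addnA subnKC // ltnW.
rewrite /y; ring.
Qed.

(** The map [L] sends the trace-zero hyperplane [H] to itself, injectively since its kernel, the
    prime field, meets [H] only in 0; by finiteness it is onto [H]. *)
Lemma quad_op_surj e : Tr e = 0 -> exists x, L x = e.
Proof.
move=> Tr_e; pose H := [set x : K | Tr x == 0].
suff : e \in L @: H by case/imsetP=> x _ ->; exists x.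
have sLH : L @: H \subset H.
  by apply/subsetP=> _ /imsetP[x _ ->]; rewrite inE Tr_quad_op.
suff /eqP-> : L @: H == H by rewrite inE Tr_e.
rewrite eqEcard sLH card_in_imset ?leqnn // => x y; rewrite !inE => /eqP Tx /eqP Ty Exy.
apply/eqP; rewrite -subr_eq0; apply/eqP/Tr_fixed_eq0; last by rewrite TrB Tx Ty subrr.
apply/eqP; rewrite -[_ == _]/(fixed_by 1 (x - y)) -quad_op_eq0.
by rewrite quad_opD Exy -quad_opD subrr quad_op_fixed ?eqxx // fixed_byE frob0.
Qed.

(** After the shift [w + z], the sum over [z] is a character sum that vanishes unless [L w = 0]. The
    surviving [w] are the [p] elements of the prime field, where [Q] is 0. *)
Lemma norm_quad_sum d : S d * (S d)^* = (p * #|fixed_by d|)%:R.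
Proof.
have -> : S d * (S d)^* = \sum_(z | fixed_by d z) \sum_(w | fixed_by d w)
    epow p (Q w) * epow p (Tr (z * (Fp_inj c * L w))).
  rewrite mulrC rmorph_sum mulr_suml; apply: eq_bigr => z fz.
  rewrite mulr_sumr (reindex_inj (addIr z)) /=.
  apply: eq_big => [w | w _]; first exact: fixed_by_addr.
  rewrite conj_epow // -!epowD //; congr (epow p _).
  by rewrite [w + z]addrC quadD mulrCA TrZ; ring.
rewrite exchange_big /=.
rewrite (eq_bigr (fun w => if w \in fixed_by 1 then #|fixed_by d|%:R else 0)).
  rewrite -big_mkcondr /= (eq_bigl (mem (fixed_by 1))) => [|w].
    by rewrite sumr_const card_fixed_by1 natrM mulr_natl.
  by apply: andb_idl => fw; rewrite fixed_byE (fixed_by1 fw).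
move=> w fw; rewrite -mulr_sumr sum_epow_Tr; last first.
  by rewrite fixed_byM ?fixed_by_Fp_inj ?fixed_by_quad_op.
rewrite mulf_eq0 -Fp_inj0 (inj_eq Fp_inj_inj) (negPf c_nz) /= quad_op_eq0 unfold_in.
by case: ifP => [fw1 | _]; rewrite ?mulr0 // quad_fixed ?epow0 ?mul1r.
Qed.

(* The rotation with matrix [a, b; -b, a], where [a ^+ 2 + b ^+ 2 = -1], maps
   the form [Q x + Q y] to its opposite. *)
Lemma quad_sum_sqr_real d : S d ^+ 2 = (S d)^* ^+ 2.
Proof.
have [a [b ab]] := oppr1_sum_two_squares p_prime p_odd.
have sqr_sum (G : K -> algC) : (\sum_(x | fixed_by d x) G x) ^+ 2 =
    \sum_(u : K * K | fixed_by d u.1 && fixed_by d u.2) G u.1 * G u.2.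
  by rewrite expr2 big_distrlr /= pair_big.
rewrite /quad_sum rmorph_sum !sqr_sum.
pose A := Fp_inj a; pose B := Fp_inj b.
have AB : A ^+ 2 + B ^+ 2 = -1.
  by rewrite !expr2 -!Fp_injM -Fp_injD -!expr2 ab Fp_injN Fp_inj1.
pose rot (u : K * K) := (A * u.1 + B * u.2, A * u.2 - B * u.1).
(* The rotation has determinant [-1], so its inverse is minus its transpose. *)
pose rot' (u : K * K) := (B * u.2 - A * u.1, - (B * u.1) - A * u.2).
have rotK : cancel rot rot'.
  move=> [x y]; rewrite /rot /rot' /=.
  have neg z : - (A ^+ 2 + B ^+ 2) * z = z by rewrite AB opprK mul1r.
  by congr (_, _); [rewrite -[RHS]neg | rewrite -[RHS]neg]; ring.
have fixA x : fixed_by d x -> fixed_by d (A * x).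
  by apply: fixed_byM; apply: fixed_by_Fp_inj.
have fixB x : fixed_by d x -> fixed_by d (B * x).
  by apply: fixed_byM; apply: fixed_by_Fp_inj.
rewrite (reindex_inj (can_inj rotK)); apply: eq_big => [u | [x y] _].
  apply/andP/andP => [[f1 f2] | [f1 f2]].
    by rewrite -[u]rotK /rot' /= !fixed_byD ?fixed_byN ?fixA ?fixB.
  by rewrite /rot /= !fixed_byD ?fixed_byN ?fixA ?fixB.
rewrite /= !conj_epow // -!epowD //; congr (epow p _).
(* With the [x] term first in both components, the two polar terms are opposite multiples of
   [Tr (x * L y)] and cancel. *)
rewrite -mulNr -Fp_injN [A * y + _]addrC !quadD !quadZ !quad_opZ.
have cross u v : Tr (Fp_inj u * x * (Fp_inj v * L y)) = u * v * Tr (x * L y).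
  by rewrite mulrACA -Fp_injM TrZ.
have -> : - Q x - Q y = (a ^+ 2 + b ^+ 2) * (Q x + Q y) by rewrite ab; ring.
by rewrite /A !cross; ring.
Qed.

End OneForm.

(** * Congruences modulo primes and independence of the form *)

Lemma quad_sum_mod_prime c r t (l m : nat) : prime l ->
  (quad_sum c r t (l * m) == quad_sum c r t m %[mod l])%A.
Proof.
move=> l_prime; set d := (l * m)%N.
have fix_d x : fixed_by m x -> fixed_by d x by move=> /eqP fx; apply/eqP/frob_period.
(* Extension by the identity gives a permutation of all of [K]. *)
pose f x := if fixed_by d x then frob m x else x.
have f_inj : injective f.
  move=> x y; rewrite /f; case: ifPn => fx; case: ifPn => fy //.
  - exact: frob_inj.
  - by move=> Exy; rewrite -Exy fixed_by_frob in fy.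
  - by move=> Exy; rewrite Exy fixed_by_frob in fx.
pose s := perm f_inj.
have s_fixed x : fixed_by d x -> s x = frob m x by move=> fx; rewrite permE /f fx.
have s_group : l.-group%g <[s]>%g.
  apply: (@pnat_dvd _ l); last exact: pnat_id.
  rewrite -orderE order_dvdn; apply/eqP/permP => x; rewrite perm1 permX.
  have [fx | fx] := boolP (fixed_by d x); last first.
    have sx : s x = x by rewrite permE /f (negPf fx).
    by elim: {1}l => //= i ->.
  suff it i : iter i s x = frob (i * m) x by rewrite it; apply/eqP.
  elim: i => [|i IHi]; first by rewrite frob_id.
  by rewrite iterS IHi s_fixed ?fixed_by_frob // frob_comp mulSn.
(* Grouping by the value of the form reduces the claim to level sets, where the fixed-point
   congruence for [l]-groups applies. *)
pose level e v := [set x | fixed_by e x && (quad c r t x == v)].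
have sum_level e : quad_sum c r t e = \sum_v #|level e v|%:R * epow p v.
  rewrite /quad_sum (partition_big (quad c r t) predT) //=; apply: eq_bigr => v _.
  rewrite (eq_bigr (fun=> epow p v)) => [|x /andP[_ /eqP->] //].
  by rewrite sumr_const mulr_natl; congr (_ *+ _); rewrite cardsE.
have level_mod v : #|level d v| = #|level m v| %[mod l].
  rewrite (pgroup_fix_mod (to := 'P) s_group).
    congr (_ %% _)%N; apply: eq_card => x; rewrite in_setI afix_cycle [x \in level d v]in_set [in RHS]in_set.
    apply/andP/andP => [[/andP[fx Qx] /afix1P]| [fx Qx]].
      by rewrite /= apermE s_fixed // => sx; split=> //; apply/eqP.
    rewrite (fix_d _ fx) Qx; split=> //; apply/afix1P.
    by rewrite /= apermE s_fixed ?fix_d //; apply/eqP.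
  rewrite cycle_subG; apply/astabsP => x; rewrite /= apermE !inE.
  rewrite permE /f; case: ifP => fx; last by rewrite fx.
  by rewrite fixed_by_frob // quad_frob.
rewrite !sum_level /eqAmod -sumrB; apply: rpred_sum => v _.
have : (#|level d v|%:R == #|level m v|%:R %[mod l])%A.
  by rewrite eqAmod_nat level_mod.
exact/eqAmodMr/Aint_epow.
Qed.

Lemma Aint_quad_sum c r t d : quad_sum c r t d \in Aint.
Proof. by apply: rpred_sum => x _; apply: Aint_epow. Qed.

Definition admissible (c : 'F_p) (r t : nat) :=
  [/\ c != 0, (t < r)%N, coprime n (r + t) & coprime n (r - t)].

Lemma norm_quad_sum_adm c r t d : admissible c r t ->
  quad_sum c r t d * (quad_sum c r t d)^* = (p * #|fixed_by d|)%:R.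
Proof. by case=> *; apply: norm_quad_sum. Qed.

Lemma quad_sum_indep c r t c' r' t' d : odd n ->
  admissible c r t -> admissible c' r' t' -> (d %| n)%N ->
  quad_sum c r t d = quad_sum c' r' t' d.
Proof.
move=> n_odd adm adm'; elim/ltn_ind: d => d IHd d_n.
have d_gt0 := dvdn_gt0 n_gt0 d_n.
(* Base case: both forms vanish on the prime field. *)
have [-> | d_neq1] := eqVneq d 1%N.
  by apply: eq_bigr => x fx; rewrite !quad_fixed.
have d_gt1 : (1 < d)%N by rewrite ltn_neqAle eq_sym d_neq1.
pose l := pdiv d; pose m := (d %/ l)%N.
have l_prime : prime l by apply: pdiv_prime.
have Ed : d = (l * m)%N by rewrite mulnC divnK ?pdiv_dvd.
have l_n : (l %| n)%N by apply: dvdn_trans d_n; apply: pdiv_dvd.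
have ST : (quad_sum c r t d == quad_sum c' r' t' d %[mod l])%A.
  rewrite Ed; apply: eqAmod_trans (quad_sum_mod_prime _ _ _ _ l_prime) _.
  rewrite (IHd m) ?ltn_Pdiv ?prime_gt1 //; last first.
    by apply: dvdn_trans d_n; rewrite Ed dvdn_mull.
  by rewrite eqAmod_sym quad_sum_mod_prime.
(* The square of the sum equals that of its conjugate, so the fourth power is the fourth power of
   the modulus. *)
have S4 a u v : admissible a u v ->
    quad_sum a u v d ^+ 4 = (p * #|fixed_by d|)%:R ^+ 2.
  move=> /norm_quad_sum_adm <-; rewrite exprMn -quad_sum_sqr_real.
  by rewrite -exprD.
have := S4 _ _ _ adm; rewrite -(S4 _ _ _ adm').
have := norm_quad_sum_adm d adm'; move: ST (Aint_quad_sum c' r' t' d).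
move: (quad_sum c r t d) (quad_sum c' r' t' d) (Aint_quad_sum c r t d).
set N := (p * _)%N => S T AintS ST AintT normT.
move/eqP; rewrite -subr_eq0 subrXX mulf_eq0 subr_eq0 => /orP[/eqP // | /eqP sum0].
(* If [S != T], then [0 = S^3 + S^2 T + S T^2 + T^3 = 4 T^3] modulo [l], which
   contradicts that [T * T^*] is prime to [l]. *)
have modX i : (S ^+ i == T ^+ i %[mod l])%A.
  elim: i => [|i IHi]; first exact: eqAmod_refl.
  by rewrite !exprS; apply: eqAmodM; rewrite ?rpredX.
have : (T ^+ 3 *+ 4 == 0 %[mod l])%A.
  rewrite -sum0 eqAmod_sym.
  have -> : T ^+ 3 *+ 4 = \sum_(i < 4) T ^+ 3 by rewrite sumr_const card_ord.
  rewrite /eqAmod -sumrB.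
  apply: rpred_sum => i _.
  have -> : T ^+ 3 = T ^+ (4.-1 - i) * T ^+ i.
    by rewrite -exprD subnK // -ltnS.
  by apply: eqAmodMr; rewrite ?rpredX.
(* Multiplying by the cube of the conjugate turns [4 T^3] into the integer [4 N^3]. So [l] is 2, [p]
   or a divisor of a power of [p]; but [l] divides [n], which is odd and prime to [p]. *)
have AintT' : T^* ^+ 3 \in Aint by rewrite rpredX ?Aint_aut.
move/(eqAmodMr AintT'); rewrite mul0r mulrnAl -exprMn normT -natrX -mulrnA.
rewrite eqAmod0_nat => l_dvd.
have l_neq2 : (l == 2) = false.
  by apply/eqP=> l2; move: l_n; rewrite l2 dvdn2 n_odd.
have l_neq_p : (l == p) = false.
  by apply/eqP=> lp; move: copnp; rewrite coprime_sym prime_coprime // -lp l_n.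
move: l_dvd; rewrite Euclid_dvdM // -[4%N]/(2 ^ 2)%N !Euclid_dvdX //.
rewrite [(l %| 2)%N]dvdn_prime2 // l_neq2 orbF andbT /N Euclid_dvdM //.
rewrite dvdn_prime2 // l_neq_p.
move=> /= /dvdn_trans /(_ (card_fixed_by_dvd d)).
by rewrite Euclid_dvdX // dvdn_prime2 // l_neq_p.
Qed.

Lemma fixed_by_n x : fixed_by n x.
Proof. by rewrite fixed_byE -[n]mul1n frob_n. Qed.

(** Completing the square: [Tr e = 0] provides [h] with [c * L h = - e], and the shift by [h]
    cancels the linear term. *)
Lemma sum_quad_linear c r t e : admissible c r t -> Tr e = 0 ->
  exists v, \sum_x epow p (quad c r t x + Tr (e * x)) = epow p v * quad_sum c r t n.
Proof.
case=> c_nz tr cop_add cop_sub Tr_e.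
have [|h Lh] := @quad_op_surj r t tr cop_add cop_sub (Fp_inj (- c^-1) * e).
  by rewrite TrZ Tr_e mulr0.
exists (quad c r t h + Tr (e * h)); rewrite mulr_sumr (reindex_inj (addIr h)) /=.
apply: eq_big => [x | x _]; first by rewrite fixed_by_n.
rewrite -epowD //; congr (epow p _).
rewrite quadD Lh mulrCA TrZ mulrDr TrD [x * e]mulrC mulrA mulrN divff //.
ring.
Qed.

(** Since 1 lies in the radical and the form vanishes there, translation by 1 only adds [Tr e]. *)
Lemma sum_quad_linear_eq0 c r t e : Tr e != 0 ->
  \sum_x epow p (quad c r t x + Tr (e * x)) = 0.
Proof.
move=> Tr_e.
apply: (@epow_sum_shift _ p_prime p_odd _ predT _ 1 (Tr e)) => // x _.
rewrite quadD quad_op_fixed ?fixed_byE /frob ?expr1n // mulr0 Tr0 mulr0.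
by rewrite [quad c r t 1]quad_fixed ?fixed_byE /frob ?expr1n // mulrDr mulr1 TrD !addr0 addrA.
Qed.

End FrobeniusTrace.

(** * Interpolation over the prime field *)

Lemma prod_sub_Fp (p : nat) (y : 'F_p) : prime p ->
  \prod_(j : 'F_p | j != y) (y - j) = -1.
Proof.
(* The product is the derivative at [y] of the product of all ['X - j], which is ['X^p - 'X]. *)
move=> p_prime; have := congr1 (fun P => P^`().[y]) (finField_genPoly 'F_p).
rewrite (bigD1 y) //= derivM !derivE card_Fp // !hornerE horner_prod subrr mul0r addr0.
rewrite (eq_bigr (fun j => y - j)) => [<- | j _]; last by rewrite !hornerE.
by rewrite hornerMn -mulr_natr pchar_Fp_0 // mulr0 add0r.
Qed.

Lemma interpolation_Fp (p : nat) (y : 'F_p) (G : 'F_p -> 'F_p) : prime p ->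
  (p.-1)%:R * \sum_(k : 'F_p) (\prod_(j : 'F_p | j != k) (y - j)) * G k = G y.
Proof.
move=> p_prime.
have -> : (p.-1)%:R = -1 :> 'F_p.
  by apply/eqP; rewrite -addr_eq0 natr1 prednK ?prime_gt0 // pchar_Fp_0.
rewrite (bigD1 y) //= prod_sub_Fp // big1 ?addr0 => [|k k_neq]; first by rewrite !mulN1r opprK.
by rewrite (bigD1 y) 1?eq_sym //= subrr !mul0r.
Qed.

(** * The Walsh transform of the interpolated function *)

Unset Implicit Arguments.
Set Strict Implicit.
Set Printing Implicit Defensive.

Theorem theorem8 (p n : nat) (K : finFieldType)
  (p_prime : prime p) (p_odd : odd p) (n_odd : odd n)
  (charK : p \in [pchar K]) (cardK : #|K| = (p ^ n)%N)
  (c : 'F_p -> 'F_p) (r t : 'F_p -> nat) (b : 'F_p -> K)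
  (c_nz : forall k, c k != 0)
  (rt : forall k, (t k < r k)%N)
  (cop1 : forall k, coprime n (r k + t k))
  (cop2 : forall k, coprime n (r k - t k))
  (copnp : coprime n p) :
  let g := fun (k : 'F_p) (x : K) =>
    c k * Tr p n (x ^+ (p ^ r k).+1 - x ^+ (p ^ t k).+1) in
  (forall k : 'F_p, g k 1 + Tr p n (b k) = g 0 1 + k) ->
  let f := fun (k : 'F_p) (x : K) => g k x + Tr p n (b k * x) in
  let F := fun (x : K) (y : 'F_p) =>
    (p.-1)%:R * \sum_(k : 'F_p) (\prod_(j : 'F_p | j != k) (y - j)) * f k x in
  weakly_regular_bent p n F.
Proof.
move=> g g1 f F.
have adm k : admissible n (c k) (r k) (t k) by split.
have quad1 k : g k 1 = 0 by rewrite /g !expr1n subrr (Tr0 p_prime charK cardK) mulr0.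
have Tr_b k : Tr p n (b k) = k.
  have := g1 k; rewrite !quad1 !add0r; exact.
pose S := quad_sum n K (c 0) (r 0) (t 0) n.
have walshE a b0 : exists v, walsh p n F a b0 = epow p v * S.
  have Tr_e : Tr p n (b (Tr p n a) - a) = 0.
    by rewrite (TrB p_prime charK cardK) Tr_b subrr.
  have [v Ev] := sum_quad_linear p_prime p_odd charK cardK copnp
    (adm (Tr p n a)) Tr_e.
  (* Only the slice [y = Tr p n a] survives, because [b y - a] has trace [y - Tr p n a]. *)
  exists (v - b0 * Tr p n a); rewrite /walsh exchange_big /=.
  have inner y : \sum_x epow p (F x y - Tr p n (a * x) - b0 * y) =
      epow p (- (b0 * y)) * \sum_x epow p (quad n (c y) (r y) (t y) x +
                                           Tr p n ((b y - a) * x)).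
    rewrite mulr_sumr; apply: eq_bigr => x _; rewrite -epowD //; congr (epow p _).
    have -> : Tr p n ((b y - a) * x) = Tr p n (b y * x) - Tr p n (a * x).
      by rewrite mulrBl (TrB p_prime charK cardK).
    rewrite /F interpolation_Fp // /f -[quad _ _ _ _ x]/(g y x); ring.
  rewrite (bigD1 (Tr p n a)) //= [X in _ + X]big1 ?addr0 => [|y y_neq].
    rewrite inner Ev mulrA -epowD // [- _ + v]addrC; congr (_ * _).
    (* The surviving Gauss sum belongs to the index [Tr p n a]; independence of the form replaces it
       by that of index 0. *)
    exact: quad_sum_indep.
  by rewrite inner sum_quad_linear_eq0 ?mulr0 // (TrB p_prime charK cardK) Tr_b subr_eq0.
have normS : `|S| ^+ 2 = (p ^ n.+1)%:R.
  rewrite normCK (norm_quad_sum_adm p_prime p_odd charK cardK copnp) // expnS -cardK.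
  by congr (_ * _)%:R; apply: eq_card => x; apply: (fixed_by_n cardK).
have normW a b0 : `|walsh p n F a b0| ^+ 2 = (p ^ n.+1)%:R.
  by have [v ->] := walshE a b0; rewrite normrM norm_epow // mul1r.
split=> //; exists ((sqrtC (p ^ n.+1)%:R)^-1 * S).
(* Finite choice collects the exponents [v] into the dual function. *)
have [Fs FsE] := fin_all_exists (fun u : K * 'F_p => walshE u.1 u.2).
exists (fun a b0 => Fs (a, b0)); split=> [|a b0].
  apply/eqP; rewrite -(@pexpr_eq1 _ _ 2) // normrM exprMn normS normfV exprVn.
  rewrite -normrX sqrtCK normr_nat mulVf // pnatr_eq0 expn_eq0.
  by rewrite eqn0Ngt prime_gt0.
by rewrite (FsE (a, b0)) [epow _ _ * S]mulrC mulrA.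
Qed.
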